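(* Let $a$ and $b$ be two coprime positive integers, with $b\geq 2$. Then, for any integer $n\geq b+1$, we have \[L_{a,b,n}\leq \left(c_1\cdot b\log b\right)^{n+\left\lfloor \frac{a}{b}\right\rfloor},\] where $c_1=41.30142$.
   Context: For positive integers $a,b$ and a natural number $n$, $L_{a,b,n}:=\mathrm{lcm}(a,a+b,a+2b,\dots,a+nb)$. Here $\lfloor\cdot\rfloor$ is the integer-part (floor) function and $\log$ is the natural logarithm. *)

(* Defs.v *)
From Stdlib Require Import Reals.
From mathcomp Require Import all_boot.

Set Implicit Arguments.
Unset Strict Implicit.
Unset Printing Implicit Defensive.

(* lcm(a, a + b, ..., a + n b): the n.+1 terms i = 0, ..., n. *)
Definition lcm_ap (a b n : nat) : nat :=
  \big[lcmn/1]_(0 <= i < n.+1) (a + i * b).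

(* Main.v *)
Require Import Defs.
From HB Require Import structures.
From Stdlib Require Import Reals Lra.
From mathcomp Require Import all_boot zify.

(** Write [a = r + q * b] with [0 < r < b].  The terms [a, ..., a + n * b] are
    among the terms [r, ..., r + N * b] with [N = n + q], which is why the
    exponent is [n + a %/ b]; it remains to treat first terms that are at most
    [b].

    For a prime [p] not dividing [b], the [N.+1] terms of the progression are
    spread evenly modulo the powers of [p], so that their product [P] contains
    all the factors [p] of [N.+1`!], while their lcm [L] contains only those of
    a single term.  Precisely, [L * (N.+1`!)`_\pi(b)^'] divides [P * l], where
    [l] is the lcm of [1, ..., N.+1] ([lcm_ap_mul_p'fact_dvd]).  The same
    result for consecutive integers gives [l <= 4 ^ N.+1], by halving the
    interval ([lcm_upto_le]).  As [P <= b ^ N.+1 * N.+1`!], it follows that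
    [L <= (4 * b) ^ N.+1 * (N.+1`!)`_\pi(b)] ([lcm_ap_le_part_fact]).

    By Legendre's formula the last factor is at most [D ^ N], where [D] is the
    product of the [p ^ (1 / (p - 1))] over the primes [p] dividing [b]
    ([ln_part_fact_le]).  This is where the factor [ln b] comes from.  The
    primes larger than [n] contribute at most [b ^ (1 / n)] to [D].
    The smaller ones are controlled by comparing [n / (p - 1)] with the
    valuation of [n`!] at [p]: they contribute at most [n`! ^ (1 / n)], up to
    a constant ([sum_ln_div_pred_le]).  With [n] close to [ln b], the first
    bound is a constant and the second is of order [ln b].

    The constant 41.30142 leaves a margin.  For [b < 64] the choice [n = 2],
    which gives [D <= 2 * sqrt b], is enough; for [b >= 64], [n] is [ln b]
    rounded up.  The hypothesis [b + 1 <= n] bounds the cost of the one extra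
    factor [4 * b]. *)

Local Open Scope nat_scope.

(** * Divisibility properties of the lcm of a progression *)

Lemma lcm_ap_dvdP a b n d :
  reflect (forall i, i <= n -> a + i * b %| d) (lcm_ap a b n %| d).
Proof.
rewrite /lcm_ap big_mkord; apply: (iffP (dvdn_biglcmP _ _ _)) => [h i le_in|h i _].
  by have := h (Ordinal (le_in : i < n.+1)) isT.
exact: h (ltn_ord i).
Qed.

Lemma lcm_ap_dvd a b n i : i <= n -> a + i * b %| lcm_ap a b n.
Proof. by move: i; apply/lcm_ap_dvdP. Qed.

Lemma lcm_ap_gt0 a b n : 0 < a -> 0 < lcm_ap a b n.
Proof.
move=> a_gt0; rewrite /lcm_ap; elim/big_ind: _ => // [m k|i _].
  by rewrite lcmn_gt0 => -> ->.
by rewrite addn_gt0 a_gt0.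
Qed.

Lemma prod_consecutive_mul_fact x k :
  (\prod_(0 <= i < k) (x.+1 + i)) * x`! = (x + k)`!.
Proof.
elim: k => [|k IHk]; first by rewrite big_nil addn0 mul1n.
by rewrite big_nat_recr //= mulnAC IHk addnS factS mulnC addSn.
Qed.

Lemma fact_dvd_prod_consecutive x k : k`! %| \prod_(0 <= i < k) (x + i).
Proof.
case: x => [|x].
  by case: k => [|k] //; rewrite big_nat_recl // mul0n dvdn0.
rewrite -(dvdn_pmul2r (fact_gt0 x)) prod_consecutive_mul_fact.
by rewrite -(bin_fact (leq_addl x k)) addnK dvdn_mull.
Qed.

(** Modulo a number coprime to [b], the step [b] is invertible, so the product
    of [k] terms is a multiple of the product of [k] consecutive integers. *)
Lemma p'fact_dvd_prod_ap a b k :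
  0 < b -> (k`!)`_\pi(b)^' %| \prod_(0 <= i < k) (a + i * b).
Proof.
move=> b_gt0; set d := _`_ _.
have d_gt0: 0 < d by apply: part_gt0.
have co_db: coprime d b.
  by rewrite coprime_sym -[X in coprime X _](partn_pi b_gt0) coprime_partC.
have [[c v] /= cvE] : exists u, u.1 * b - u.2 * d = 1.
  by apply/(coprimeP _ b_gt0); rewrite coprime_sym.
have cb1: c * b = 1 + v * d by lia.
have ap_mod i : a + i * b = b * (c * a + i) %[mod d].
  have -> : b * (c * a + i) = a * v * d + (a + i * b) by nia.
  by rewrite modnMDl.
have prod_mod: \prod_(0 <= i < k) (a + i * b)
    = \prod_(0 <= i < k) (b * (c * a + i)) %[mod d].
  elim/big_rec2: _ => // i x y _ xy.
  by rewrite -modnMm xy ap_mod modnMm.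
rewrite /dvdn prod_mod -/(dvdn _ _) big_split /= dvdn_mull //.
exact: dvdn_trans (dvdn_part _ _) (fact_dvd_prod_consecutive _ _).
Qed.

(** The numbers [1 / (m.+1 * 'C(m, j))] form Leibniz's harmonic triangle: each
    entry with [j > 0] is the difference of two entries with a smaller [j], and
    the entries for [j = 0] are [1 / m.+1].  Hence every entry is an integral
    combination of [1, 1/2, ..., 1/m.+1], and becomes an integer when
    multiplied by the lcm of the denominators. *)
Lemma leibniz_dvd_lcm m j : j <= m -> m.+1 * 'C(m, j) %| lcm_ap 1 1 m.
Proof.
elim: j m => [|j IHj] m le_jm.
  by rewrite bin0 muln1; have:= @lcm_ap_dvd 1 1 m m (leqnn m); rewrite muln1.
case: m le_jm => // m le_jm; set l := lcm_ap 1 1 m.+1.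
have [s lE_s]: exists s, l = s * (m.+1 * 'C(m, j)).
  apply/dvdnP/(dvdn_trans (IHj m le_jm))/lcm_ap_dvdP => i le_im.
  by apply: lcm_ap_dvd; lia.
have [t lE_t] : exists t, l = t * (m.+2 * 'C(m.+1, j)).
  by apply/dvdnP/IHj; lia.
have := mul_bin_diag m.+1 j; have := mul_bin_down m.+1 j => /=.
have: 0 < 'C(m, j) by rewrite bin_gt0.
have: 0 < 'C(m.+1, j) by rewrite bin_gt0; lia.
move: lE_s lE_t; rewrite -/l.
move: 'C(m, j) 'C(m.+1, j) 'C(m.+1, j.+1) => x y z lE_s lE_t y_gt0 x_gt0 xy xz.
apply/dvdnP; exists (s - t).
apply/eqP; rewrite -(@eqn_pmul2l (m.+1 * x * (m.+2 * y))); last by lia.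
apply/eqP.
(* 1/(m.+2 z) = 1/(m.+1 x) - 1/(m.+2 y), cleared of denominators *)
have e1 : m.+2 * z * (m.+2 * y - m.+1 * x) = m.+1 * x * (m.+2 * y).
  have -> : m.+2 * y - m.+1 * x = j.+1 * y by nia.
  nia.
rewrite -{1}e1 mulnBr mulnBl.
have e2 : m.+1 * x * (m.+2 * y) * ((s - t) * (m.+2 * z))
    = m.+2 * z * (m.+2 * y * l) - m.+2 * z * (m.+1 * x * l).
  rewrite {1}lE_s lE_t mulnBl mulnBr; congr (_ - _); nia.
by rewrite e2 -!mulnA.
Qed.

(** Removing the term of index [j] from the progression leaves runs of [j] and
    [m - j] terms, whose products absorb the parts prime to [b] of [j`!] and
    [(m - j)`!]; the quotient of [m.+1`!] by [j`! * (m - j)`!] is a Leibniz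
    denominator. *)
Lemma term_mul_p'fact_dvd a b m j : 0 < b -> j <= m ->
  (a + j * b) * (m.+1`!)`_\pi(b)^'
    %| (\prod_(0 <= i < m.+1) (a + i * b)) * lcm_ap 1 1 m.
Proof.
move=> b_gt0 le_jm.
have -> : m.+1`! = m.+1 * 'C(m, j) * (j`! * (m - j)`!).
  by rewrite factS -(bin_fact le_jm) mulnA.
rewrite !partnM ?muln_gt0 ?fact_gt0 ?bin_gt0 //.
have -> : \prod_(0 <= i < m.+1) (a + i * b) = \prod_(0 <= i < j) (a + i * b)
    * ((a + j * b) * \prod_(0 <= i < m - j) (a + j.+1 * b + i * b)).
  rewrite (@big_cat_nat _ _ _ j) //=; last by lia.
  rewrite (@big_ltn _ _ _ j) // -[j.+1]add0n big_addn add0n subSS.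
  by congr (_ * (_ * _)); apply: eq_bigr => i _; lia.
set P1 := \prod_(0 <= i < j) _; set P2 := \prod_(_ <= i < _) _.
rewrite -partnM ?bin_gt0 //.
set u := _`_ _; set v := _`_ _; set w := _`_ _.
have -> : P1 * ((a + j * b) * P2) * lcm_ap 1 1 m
  = (a + j * b) * (lcm_ap 1 1 m * (P1 * P2)) by lia.
rewrite dvdn_mul // dvdn_mul ?dvdn_mul ?p'fact_dvd_prod_ap //.
exact: dvdn_trans (dvdn_part _ _) (leibniz_dvd_lcm m j le_jm).
Qed.

(** The left-hand factor [(m.+1`!)`_\pi(b)^'] is the same for every term, so
    the divisibility passes from the terms to their lcm. *)
Lemma lcm_ap_mul_p'fact_dvd a b m : 0 < b ->
  lcm_ap a b m * (m.+1`!)`_\pi(b)^'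
    %| (\prod_(0 <= i < m.+1) (a + i * b)) * lcm_ap 1 1 m.
Proof.
move=> b_gt0; set d := _`_ _; set X := _ * lcm_ap 1 1 m.
have d_gt0 : 0 < d by apply: part_gt0.
have /dvdnP[Y XE] : d %| X.
  exact: dvdn_trans (dvdn_mull _ _) (term_mul_p'fact_dvd a b m 0 b_gt0 isT).
rewrite XE dvdn_pmul2r //; apply/lcm_ap_dvdP => i le_im.
rewrite -(dvdn_pmul2r d_gt0) -XE; exact: term_mul_p'fact_dvd.
Qed.

(** * The lcm of the first integers *)

Lemma bin_half_le n : 'C(n, uphalf n) <= 4 ^ n./2.
Proof.
have bin_sum k : \sum_(i < k.+1) 'C(k, i) = 2 ^ k.
  by rewrite -[2]/(1 + 1) expnDn; apply: eq_bigr => i _; rewrite !exp1n !muln1.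
rewrite uphalf_half -[4]/(2 ^ 2) -expnM mul2n.
have := odd_double_half n; case: (odd n) => /= n_eq.
(* for odd n, two equal central coefficients share the sum 2 ^ n *)
- rewrite -(leq_pmul2l (isT : 0 < 2)) -expnS -[_.*2.+1]add1n n_eq.
  rewrite -bin_sum mul2n -addnn.
  rewrite (_ : 1 + n./2 = n - n./2); last by lia.
  rewrite bin_sub; last by lia.
  rewrite (bigD1 (inord n./2)) //= (bigD1 (inord (n - n./2))) /=.
    by rewrite !inordK ?bin_sub; lia.
  by rewrite -val_eqE /= !inordK; lia.
- rewrite add0n; move: n_eq; rewrite add0n => n_eq.
  rewrite n_eq -bin_sum (bigD1 (inord n./2)) //= inordK; lia.
Qed.

(** The integers above [u = uphalf n], up to [n], form a progression of common
    difference 1 with [n - u] terms, and their product is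
    ['C(n, u) * (n - u)`!].  So the bound for progressions shows that their lcm
    divides ['C(n, u)] times the lcm of the integers up to [n - u <= u]. *)
Lemma lcm_upto_halving n : 1 < n ->
  lcm_ap 1 1 n.-1 %| lcm_ap 1 1 (uphalf n).-1 * 'C(n, uphalf n).
Proof.
move=> n_gt1; have n_eq := odd_double_half n.
set h := n./2 in n_eq *; have uE : uphalf n = odd n + h by rewrite uphalf_half.
set u := uphalf n in uE *.
have h_gt0: 0 < h by lia.
have := @lcm_ap_mul_p'fact_dvd u.+1 1 h.-1 isT; rewrite prednK //.
have -> : (h`!)`_\pi(1)^' = h`!.
  by rewrite -[RHS]partnT ?fact_gt0 //; apply: eq_partn.
have -> : \prod_(0 <= i < h) (u.+1 + i * 1) = 'C(n, u) * h`!.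
  apply/eqP; rewrite -(@eqn_pmul2r u`!) ?fact_gt0 //; apply/eqP.
  rewrite -mulnA [h`! * _]mulnC (_ : h = n - u) ?bin_fact; try by lia.
  under eq_bigr => i _ do rewrite muln1.
  by rewrite prod_consecutive_mul_fact; congr _`!; lia.
rewrite mulnAC dvdn_pmul2r ?fact_gt0 // mulnC => top_dvd.
have low_dvd : lcm_ap 1 1 h.-1 %| lcm_ap 1 1 u.-1.
  by apply/lcm_ap_dvdP => i le_i; apply: lcm_ap_dvd; lia.
apply/lcm_ap_dvdP => i le_i; case: (ltnP i u) => [lt_iu|le_ui].
  by apply: dvdn_mulr; apply: lcm_ap_dvd; lia.
apply: (dvdn_trans _ (dvdn_mul low_dvd (dvdnn _))).
apply: dvdn_trans top_dvd.
rewrite (_ : 1 + i * 1 = u.+1 + (i - u) * 1); last by lia.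
by apply: lcm_ap_dvd; lia.
Qed.

Lemma lcm_upto_le n : lcm_ap 1 1 n <= 4 ^ n.+1.
Proof.
have [k] := ubnP n; elim: k n => // k IHk n lt_nk.
case: n lt_nk => [|n] lt_nk; first by rewrite /lcm_ap big_nat1.
have uE := uphalf_half n.+2; have n_eq := odd_double_half n.+2.
have u_gt0 : 0 < uphalf n.+2 by lia.
have /dvdn_leq := @lcm_upto_halving n.+2 isT.
rewrite muln_gt0 lcm_ap_gt0 // bin_gt0 => /(_ ltac:(lia)) le_l.
apply: (leq_trans le_l).
have -> : 4 ^ n.+2 = 4 ^ uphalf n.+2 * 4 ^ (n.+2)./2.
  by rewrite -expnD; congr (4 ^ _); lia.
apply: leq_mul (bin_half_le n.+2).
have := IHk (uphalf n.+2).-1; rewrite prednK //; apply; lia.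
Qed.

(** * An integral bound for progressions with small first term *)

Lemma prod_ap_le a b m : a <= b ->
  \prod_(0 <= i < m) (a + i * b) <= b ^ m * m`!.
Proof.
move=> le_ab; elim: m => [|m IHm]; first by rewrite big_nil.
rewrite big_nat_recr //= expnS factS.
have: a + m * b <= m.+1 * b by lia.
by move/(leq_mul IHm) => /leq_trans; apply; nia.
Qed.

(** The product of the terms is at most [b ^ m.+1 * m.+1`!], and the part of
    the factorial prime to [b] cancels: only its [b]-part remains. *)
Lemma lcm_ap_le_part_fact a b m : 0 < a -> a <= b ->
  lcm_ap a b m <= (4 * b) ^ m.+1 * (m.+1`!)`_\pi(b).
Proof.
move=> a_gt0 le_ab; have b_gt0 : 0 < b by lia.
have d_gt0 : 0 < (m.+1`!)`_\pi(b)^' by apply: part_gt0.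
have prod_gt0 : 0 < \prod_(0 <= i < m.+1) (a + i * b).
  by apply: prodn_gt0 => i; rewrite addn_gt0 a_gt0.
have /dvdn_leq := lcm_ap_mul_p'fact_dvd a b m b_gt0.
rewrite muln_gt0 prod_gt0 lcm_ap_gt0 // => /(_ isT) le_l.
rewrite -(leq_pmul2r d_gt0) -mulnA partnC ?fact_gt0 //.
apply: (leq_trans le_l); rewrite expnMn -mulnA mulnC leq_mul //.
  exact: lcm_upto_le.
exact: prod_ap_le.
Qed.

(** By Legendre's formula the valuation is [(m - s) / (p - 1)], where [s >= 1]
    is the sum of the digits of [m] in base [p].  Having [m.-1] instead of [m]
    lets the [b]-part of [N.+1`!] be compared with an [N]-th power. *)
Lemma logn_fact_le p m : prime p -> 0 < m -> logn p m`! * p.-1 <= m.-1.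
Proof.
move=> p_pr m_gt0; have p_gt1 := prime_gt1 p_pr.
rewrite logn_fact // big_add1 /=.
(* With q_k = m %/ p ^ k, the inequality p * q_k.+1 <= q_k makes the sum
   telescope; the maximum keeps the last nonzero quotient, hence the gain
   of 1. *)
suff /(_ m) h K : (\sum_(0 <= k < K) m %/ p ^ k.+1) * p.-1
    + maxn 1 (m %/ p ^ K) <= m by lia.
elim: K => [|k IHk]; first by rewrite big_nil divn1; lia.
rewrite big_nat_recr //= mulnDl.
have -> : m %/ p ^ k.+1 = (m %/ p ^ k) %/ p by rewrite expnSr divnMA.
move: IHk; set q := m %/ p ^ k; set s := \sum_(_ <= _ < _) _.
have := leq_trunc_div q p; case: (q %/ p) => [|r] le_q; nia.
Qed.

Lemma lcm_ap_shift a b n : lcm_ap a b n %| lcm_ap (a %% b) b (n + a %/ b).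
Proof.
apply/lcm_ap_dvdP => i le_in.
rewrite {1}(divn_eq a b) (_ : _ + _ = a %% b + (i + a %/ b) * b); last by lia.
by apply: lcm_ap_dvd; lia.
Qed.

(** * Finite sums and logarithms *)

Local Open Scope R_scope.

HB.instance Definition _ := Monoid.isComLaw.Build R 0 Rplus
  (fun x y z => esym (Rplus_assoc x y z)) Rplus_comm Rplus_0_l.

Local Notation "\rsum_ ( i <- r ) F" := (\big[Rplus/0]_(i <- r) F)
  (at level 41, i at level 50, r at level 50, F at level 41).

Lemma rsum_le (r : seq nat) (F G : nat -> R) :
  (forall i, i \in r -> F i <= G i) -> \rsum_(i <- r) F i <= \rsum_(i <- r) G i.
Proof.
move=> leFG; rewrite big_seq [X in _ <= X]big_seq.
by elim/big_ind2: _ => [|x1 x2 y1 y2 ? ?|i /leFG]; lra.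
Qed.

Lemma rsum_scale (c : R) (r : seq nat) (F : nat -> R) :
  \rsum_(i <- r) (c * F i) = c * \rsum_(i <- r) F i.
Proof.
by rewrite (big_morph (Rmult c) (Rmult_plus_distr_l c) (Rmult_0_r c)).
Qed.

Lemma rsum_le_subset (r s : seq nat) (F : nat -> R) :
  uniq r -> uniq s -> {subset r <= s} -> (forall i, i \in s -> 0 <= F i) ->
  \rsum_(i <- r) F i <= \rsum_(i <- s) F i.
Proof.
move=> r_uniq s_uniq sub_rs F_ge0.
rewrite [X in _ <= X](bigID (mem r)) /=.
have -> : \rsum_(i <- r) F i = \big[Rplus/0]_(i <- s | i \in r) F i.
  rewrite -[RHS]big_filter; apply/perm_big/uniq_perm => //.
    exact: filter_uniq.
  by move=> i; rewrite mem_filter andb_idr //; apply: sub_rs.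
rewrite -[X in X <= _]Rplus_0_r; apply: Rplus_le_compat_l.
by rewrite big_seq_cond; elim/big_ind: _ => [|x y ? ?|i /andP[/F_ge0]] //; lra.
Qed.

Lemma INR_muln m n : INR (m * n)%N = INR m * INR n.
Proof. exact: mult_INR. Qed.

Lemma INR_expn m n : INR (m ^ n)%N = INR m ^ n.
Proof. by elim: n => [|n IHn] //; rewrite expnS INR_muln IHn. Qed.

Lemma leq_INR m n : (m <= n)%N -> INR m <= INR n.
Proof. by move=> /leP; apply: le_INR. Qed.

Lemma INR2 : INR 2 = 2.
Proof. by rewrite /=; lra. Qed.

Lemma INR_gt0 n : (0 < n)%N -> 0 < INR n.
Proof. by move=> /ltP; apply: lt_0_INR. Qed.

Lemma INR_predn n : (0 < n)%N -> INR n.-1 = INR n - 1.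
Proof. by case: n => // n _; rewrite S_INR /=; lra. Qed.

Lemma ln_mono x y : 0 < x -> x <= y -> ln x <= ln y.
Proof. by move=> x_gt0 [/(ln_increasing _ _ x_gt0)|->]; lra. Qed.

Lemma ln_ge0 x : 1 <= x -> 0 <= ln x.
Proof. by rewrite -ln_1 => x_ge1; apply: ln_mono; lra. Qed.

Lemma ln_part_primes b m : (0 < b)%N -> (0 < m)%N ->
  \rsum_(p <- primes b) (INR (logn p m) * ln (INR p)) = ln (INR m`_\pi(b)).
Proof.
move=> b_gt0 m_gt0.
have -> : (m`_\pi(b) = \prod_(p <- primes b) p ^ logn p m)%N.
  rewrite (@widen_partn (maxn b m)) ?leq_maxr // -big_filter.
  apply/perm_big/uniq_perm; rewrite ?filter_uniq ?iota_uniq ?primes_uniq //.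
  move=> p; rewrite mem_filter mem_index_iota andb_idr //.
  rewrite mem_primes => /and3P[_ _ /dvdn_leq]; lia.
have : all (leq 1) (primes b).
  by apply/allP => p; rewrite mem_primes => /and3P[/prime_gt0].
elim: (primes b) => [|p s IHs] /=; first by rewrite !big_nil ln_1.
case/andP=> p_gt0 s_gt0; rewrite !big_cons IHs // INR_muln INR_expn.
rewrite ln_mult ?ln_pow //.
- exact: INR_gt0.
- by apply/pow_lt/INR_gt0.
- apply: INR_gt0; elim: s s_gt0 {IHs} => [|q s IHs] /=; first by rewrite big_nil.
  by case/andP=> q_gt0 /IHs; rewrite big_cons muln_gt0 expn_gt0 q_gt0.
Qed.

(** * The weight of the prime divisors of the common difference *)

(** The logarithm of the product of the [p ^ (1 / (p - 1))] over the primes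
    [p] dividing [b], which bounds the growth rate of the [b]-part of a
    factorial. *)
Definition sum_ln_div_pred b :=
  \rsum_(p <- primes b) (ln (INR p) / (INR p - 1)).

Lemma ln_part_fact_le b N : (0 < b)%N ->
  ln (INR (N.+1`!)`_\pi(b)) <= INR N * sum_ln_div_pred b.
Proof.
move=> b_gt0; rewrite -ln_part_primes ?fact_gt0 // -rsum_scale.
apply: rsum_le => p; rewrite mem_primes => /and3P[p_pr _ _].
have p_gt1 := prime_gt1 p_pr.
have /leq_INR := logn_fact_le p N.+1 p_pr isT.
rewrite INR_muln INR_predn /=; last by lia.
have /leq_INR : (2 <= p)%N by []; rewrite INR2.
set v := INR (logn _ _) => p_ge2 le_v.
have lnp_ge0: 0 <= ln (INR p) by apply: ln_ge0; lra.
have -> : INR N * (ln (INR p) / (INR p - 1)) = INR N / (INR p - 1) * ln (INR p).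
  by field; lra.
apply: Rmult_le_compat_r => //.
apply: (Rmult_le_reg_r (INR p - 1)); first by lra.
by rewrite /Rdiv Rmult_assoc Rinv_l ?Rmult_1_r //; lra.
Qed.

Definition ln_pronic k := ln (INR k) / (INR k * (INR k - 1)).

Lemma ln_pronic_ge0 k : (2 <= k)%N -> 0 <= ln_pronic k.
Proof.
move=> /leq_INR; rewrite INR2 => k_ge2; apply: Rle_mult_inv_pos.
  by apply: ln_ge0; lra.
by apply: Rmult_lt_0_compat; lra.
Qed.

(** If [p > n], then already [1 / (p - 1) <= 1 / n].  Otherwise use
    [1 / (p - 1) = 1 / p + 1 / (p * (p - 1))] and [n / p < 1 + n %/ p]; the
    quotient [n %/ p] is at most the valuation of [n`!] at a prime [p]. *)
Lemma ln_div_pred_le p n : (2 <= p)%N -> (0 < n)%N ->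
  ln (INR p) / (INR p - 1) <=
    / INR n * (ln (INR p) + INR (n %/ p) * ln (INR p))
    + (if (p <= n)%N then ln_pronic p else 0).
Proof.
move=> p_ge2 n_gt0; have /leq_INR := p_ge2; rewrite INR2 => p2.
have n0 := INR_gt0 _ n_gt0.
have lnp_ge0: 0 <= ln (INR p) by apply: ln_ge0; lra.
rewrite -[X in X + _ * _]Rmult_1_l -Rmult_plus_distr_r.
case: ifP => le_pn.
- rewrite /ln_pronic.
  have -> : ln (INR p) / (INR p - 1)
      = / INR n * (INR n / INR p * ln (INR p)) + ln (INR p) / (INR p * (INR p - 1)).
    by field; lra.
  apply: Rplus_le_compat_r; apply: Rmult_le_compat_l.
    by left; apply: Rinv_0_lt_compat.
  apply: Rmult_le_compat_r => //.
  have /leq_INR : (n <= (1 + n %/ p) * p)%N.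
    by rewrite mulnDl mul1n addnC {1}(divn_eq n p) leq_add2l ltnW // ltn_mod; lia.
  rewrite INR_muln plus_INR [INR 1]/= => le_n.
  apply: (Rmult_le_reg_r (INR p)); first by lra.
  by rewrite /Rdiv Rmult_assoc Rinv_l ?Rmult_1_r //; lra.
- rewrite divn_small ?ltnNge ?le_pn // [INR 0]/= !Rplus_0_r Rmult_1_l.
  rewrite [X in _ <= X]Rmult_comm.
  apply: Rmult_le_compat_l => //; apply: Rinv_le_contravar => //.
  have /leq_INR : (n.+1 <= p)%N by rewrite ltnNge le_pn.
  by rewrite S_INR; lra.
Qed.

(** The parameter [n] separates small primes from large ones.  Summing the
    previous bound over the primes [p] dividing [b], the terms [ln p] add up
    to at most [ln b], and the terms [n %/ p * ln p] to at most [ln n`!]. *)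
Lemma sum_ln_div_pred_le b n : (0 < b)%N -> (0 < n)%N ->
  sum_ln_div_pred b <= (ln (INR b) + ln (INR n`!)) / INR n
             + \rsum_(k <- index_iota 2 n.+1) ln_pronic k.
Proof.
move=> b_gt0 n_gt0; have n0 := INR_gt0 _ n_gt0.
apply: Rle_trans (_ : \rsum_(p <- primes b)
   (/ INR n * (INR (logn p b) * ln (INR p) + INR (logn p n`!) * ln (INR p))
    + (if (p <= n)%N then ln_pronic p else 0)) <= _).
  apply: rsum_le => p p_b; have := p_b; rewrite mem_primes => /and3P[p_pr _ _].
  have p_ge2 := prime_gt1 p_pr.
  apply: Rle_trans (ln_div_pred_le p n p_ge2 n_gt0) _.
  apply/Rplus_le_compat_r/Rmult_le_compat_l; first by left; apply: Rinv_0_lt_compat.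
  have lnp_ge0: 0 <= ln (INR p).
    by apply: ln_ge0; have /leq_INR := p_ge2; rewrite INR2; lra.
  apply: Rplus_le_compat.
    rewrite -[X in X <= _]Rmult_1_l; apply: Rmult_le_compat_r => //.
    by apply: (leq_INR 1); rewrite logn_gt0.
  apply: Rmult_le_compat_r => //; apply: leq_INR.
  rewrite logn_fact // big_ltn // expn1; exact: leq_addr.
rewrite big_split rsum_scale big_split /= !ln_part_primes ?fact_gt0 //.
rewrite partn_pi //; apply: Rplus_le_compat.
  rewrite Rmult_comm; apply: Rmult_le_compat_r.
    by left; apply: Rinv_0_lt_compat.
  apply/Rplus_le_compat_l/ln_mono; first exact/INR_gt0/part_gt0.
  by apply/leq_INR/dvdn_leq; rewrite ?fact_gt0 ?dvdn_part.
rewrite -big_mkcond -big_filter; apply: rsum_le_subset.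
- exact/filter_uniq/primes_uniq.
- exact: iota_uniq.
- move=> p; rewrite mem_filter mem_primes mem_index_iota.
  by case/and3P=> le_pn /prime_gt1 p_gt1 _; rewrite p_gt1.
- by move=> k; rewrite mem_index_iota => /andP[k_ge2 _]; apply: ln_pronic_ge0.
Qed.

(** * Numerical estimates *)

Lemma exp_mono x y : x <= y -> exp x <= exp y.
Proof. by move=> [/exp_increasing|->]; lra. Qed.

Lemma exp_INR_mul n x : exp (INR n * x) = exp x ^ n.
Proof.
elim: n => [|n IHn]; first by rewrite Rmult_0_l exp_0.
by rewrite S_INR Rmult_plus_distr_r Rmult_1_l exp_plus IHn Rmult_comm.
Qed.

Lemma pow_one_sub_le n x : x <= 1 -> (1 - x) ^ n <= exp (- (INR n * x)).
Proof.
move=> x_le1; rewrite Ropp_mult_distr_r exp_INR_mul; apply: pow_incr.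
by have := exp_ineq1_le (- x); lra.
Qed.

(** Raising [1 - x <= exp (- x)] to a power gives as many digits as needed; 16
    subdivisions suffice for [ln 2] and 8 for [exp 1]. *)
Lemma ln2_ge : 0.671 <= ln 2.
Proof.
have := @pow_one_sub_le 16 (0.671 / 16) ltac:(lra).
rewrite (_ : - _ = Ropp 0.671); last by rewrite /=; lra.
rewrite exp_Ropp => le_exp.
suff : exp 0.671 <= 2.
  by move/(ln_mono _ _ (exp_pos _)); rewrite ln_exp.
have e_gt0 := exp_pos 0.671; apply: Rnot_lt_le => lt2.
have := Rinv_lt_contravar 2 (exp 0.671) ltac:(lra) lt2.
by move: le_exp; lra.
Qed.

Lemma exp1_le : exp 1 <= 2.92.
Proof.
have := @pow_one_sub_le 8 (1 / 8) ltac:(lra).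
rewrite (_ : - _ = Ropp 1); last by rewrite /=; lra.
rewrite exp_Ropp => le_exp; have e_gt0 := exp_pos 1.
apply: Rnot_lt_le => lt2.
have := Rinv_lt_contravar 2.92 (exp 1) ltac:(lra) lt2.
by move: le_exp; lra.
Qed.

(** From [ln (1 + 1 / k) <= 1 / k].  The right-hand side is [g k.-1 - g k] for
    [g k = (ln (k + 1) + 1) / k]. *)
Lemma ln_pronic_telescope k : (2 <= k)%N ->
  ln_pronic k <= (ln (INR k) + 1) / (INR k - 1) - (ln (INR k + 1) + 1) / INR k.
Proof.
move=> /leq_INR; rewrite INR2 => k_ge2; rewrite /ln_pronic.
set x := INR k in k_ge2 *.
have ln_succ : ln (x + 1) - ln x <= / x.
  have inv_gt0 : 0 < / x by apply: Rinv_0_lt_compat; lra.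
  have -> : x + 1 = x * (1 + / x) by field; lra.
  rewrite ln_mult; try lra.
  have := exp_ineq1_le (/ x) => /(ln_mono (1 + / x) _ ltac:(lra)).
  by rewrite ln_exp; lra.
have -> : (ln x + 1) / (x - 1) - (ln (x + 1) + 1) / x
  = (ln x + (1 - (x - 1) * (ln (x + 1) - ln x))) / (x * (x - 1)) by field; lra.
apply: Rmult_le_compat_r.
  by left; apply/Rinv_0_lt_compat/Rmult_lt_0_compat; lra.
have := Rmult_le_compat_l (x - 1) _ _ ltac:(lra) ln_succ.
have -> : (x - 1) * / x = 1 - / x by field; lra.
have : 0 < / x by apply: Rinv_0_lt_compat; lra.
lra.
Qed.

(** The term [k = 2] is kept exact, and the others telescope: starting the
    telescoping at [k = 2] would give a larger constant. *)
Lemma sum_ln_pronic_le n : (2 <= n)%N ->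
  \rsum_(k <- index_iota 2 n.+1) ln_pronic k
    <= ln 2 / 2 + (ln 3 + 1) / 2 - (ln (INR n + 1) + 1) / INR n.
Proof.
elim: n => // n IHn; rewrite leq_eqVlt => /orP[/eqP <-|n_ge2].
  by rewrite big_nat1 /ln_pronic INR2 (_ : 2 + 1 = 3); lra.
rewrite big_nat_recr //=; last by lia.
have /Rplus_le_compat := IHn n_ge2.
have /[swap]/[apply] := @ln_pronic_telescope n.+1 ltac:(lia).
rewrite -/(INR n.+1) S_INR (_ : INR n + 1 - 1 = INR n); lra.
Qed.

Lemma ln_fact_le n : (0 < n)%N -> ln (INR n`!) / INR n <= ln ((INR n + 1) / 2).
Proof.
move=> n_gt0; have n0 := INR_gt0 _ n_gt0.
(* induction, with two terms of the binomial expansion of m.+2 ^ m.+1 *)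
have fact_le m : (2 ^ m * m`! <= m.+1 ^ m)%N.
  elim: m => // m IHm; apply: (@leq_trans (2 * m.+1 ^ m.+1)).
    by rewrite factS !expnS; nia.
  rewrite -[m.+2]addn1 expnDn 2!big_ord_recl /= bin0 subn0 exp1n.
  by rewrite /bump /= bin1 exp1n subSS subn0 expnS; nia.
have := leq_INR _ _ (fact_le n).
rewrite INR_muln !INR_expn INR2 S_INR => le_f.
apply: (Rmult_le_reg_l (INR n)) => //.
rewrite -ln_pow; last by lra.
have -> : INR n * (ln (INR n`!) / INR n) = ln (INR n`!) by field; lra.
apply: ln_mono; first exact/INR_gt0/fact_gt0.
rewrite /Rdiv Rpow_mult_distr pow_inv; have p2 := pow_lt 2 n ltac:(lra).
apply: (Rmult_le_reg_l (2 ^ n)) => //.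
by field_simplify; lra.
Qed.

(** The case [n = 2] of the bound above. *)
Lemma exp_sum_ln_div_pred_sqr_le b : (0 < b)%N ->
  exp (sum_ln_div_pred b) ^ 2 <= 4 * INR b.
Proof.
move=> b_gt0; have b0 := INR_gt0 _ b_gt0.
have := @sum_ln_div_pred_le b 2 b_gt0 isT; have := sum_ln_pronic_le 2 isT.
rewrite -[2`!]/2%N INR2 (_ : 2 + 1 = 3); last by lra.
move=> le_tail le_S; rewrite -exp_INR_mul INR2.
have -> : 4 * INR b = exp (ln (4 * INR b)) by rewrite exp_ln; lra.
apply: exp_mono; rewrite ln_mult; try lra.
by rewrite (_ : 4 = 2 * 2) ?ln_mult; lra.
Qed.

(** It suffices that [16 * sqrt b <= 41.30142 * ln b].  On each dyadic block
    [2 ^ k <= b < 2 ^ k.+1] with [k <= 5], one has [ln b >= 0.671 * k] and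
    [b <= 3 * k ^ 2], and [3 * 16 ^ 2 <= (41.30142 * 0.671) ^ 2]. *)
Lemma exp_sum_ln_div_pred_le_small b : (2 <= b)%N -> (b < 64)%N ->
  8 * exp (sum_ln_div_pred b) <= 41.30142 * ln (INR b).
Proof.
move=> b_ge2 b_lt64.
have dyadic k : (0 < k)%N -> (2 ^ k <= b)%N -> (b <= 3 * (k * k))%N ->
    8 * exp (sum_ln_div_pred b) <= 41.30142 * ln (INR b).
  move=> /leq_INR k_ge1 /leq_INR le_kb /leq_INR.
  move: k_ge1; rewrite !INR_muln INR_expn [INR 3]/= [INR 1]/= INR2 in le_kb *.
  move=> k_ge1 le_bk.
  have le_ln : INR k * 0.671 <= ln (INR b).
    apply: Rle_trans (ln_mono _ _ _ le_kb); last by apply: pow_lt; lra.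
    rewrite ln_pow; last by lra.
    by have := ln2_ge; nra.
  have := exp_sum_ln_div_pred_sqr_le b ltac:(lia) => le_sqr.
  apply: Rle_trans (_ : 41.30142 * (INR k * 0.671) <= _); last by lra.
  have e_gt0 := exp_pos (sum_ln_div_pred b).
  by apply: Rsqr_incr_0; rewrite /Rsqr; nra.
case: (ltnP b 4) => [lt_b4|le4b]; first by apply: (dyadic 1%N); lia.
case: (ltnP b 8) => [lt_b8|le8b]; first by apply: (dyadic 2%N); lia.
case: (ltnP b 16) => [lt_b16|le16b]; first by apply: (dyadic 3%N); lia.
case: (ltnP b 32) => [lt_b32|le32b]; first by apply: (dyadic 4%N); lia.
by apply: (dyadic 5%N); lia.
Qed.

(** Here [n] is [ln b] rounded up: then [b ^ (1 / n) <= exp 1] and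
    [n`! ^ (1 / n) <= (n + 1) / 2 <= (ln b + 2) / 2], so that the exponential
    of the weight is at most a constant multiple of [ln b + 2]. *)
Lemma exp_sum_ln_div_pred_le_large b : (64 <= b)%N ->
  4.4 * exp (sum_ln_div_pred b) <= 41.30142 * ln (INR b).
Proof.
move=> b_ge64; have b_gt0 : (0 < b)%N by lia.
set x := ln (INR b).
have x_ge : 4.026 <= x.
  have /leq_INR := b_ge64; rewrite -[64%N]/(2 ^ 6)%N INR_expn INR2 => le_b.
  apply: Rle_trans (ln_mono _ _ _ le_b); last by apply: pow_lt; lra.
  rewrite ln_pow; last by lra.
  by have := ln2_ge; rewrite /=; lra.
have [n le_xn lt_nx] : exists2 n, x <= INR n & INR n <= x + 1.
  have [up_gt up_le] := archimed x.
  have /IZN[n n_eq] : (0 <= up x)%Z by apply: le_IZR; lra.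
  by exists n; rewrite INR_IZR_INZ -n_eq; lra.
have n_ge2 : (2 <= n)%N.
  by rewrite leqNgt; apply/negP => /leq_INR; rewrite S_INR INR2; lra.
have n_gt0 : (0 < n)%N by lia.
have n0 := INR_gt0 _ n_gt0.
have := sum_ln_div_pred_le b n b_gt0 n_gt0.
rewrite -/x Rdiv_plus_distr => le_S.
have le_tail := sum_ln_pronic_le n n_ge2; have le_fact := ln_fact_le n n_gt0.
have lnn_ge0 : 0 <= (ln (INR n + 1) + 1) / INR n.
  by apply: Rle_mult_inv_pos => //; have := ln_ge0 (INR n + 1); lra.
have x_n : x / INR n <= 1.
  by apply: (Rmult_le_reg_r (INR n)) => //; rewrite /Rdiv Rmult_assoc Rinv_l; lra.
set K := 1 + (ln 2 / 2 + (ln 3 + 1) / 2).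
(* exp K ^ 2 = 6 * exp 3, and 6 * 2.92 ^ 3 < 12.3 ^ 2 *)
have expK : exp K <= 12.3.
  have : exp K ^ 2 <= 6 * 2.92 ^ 3.
    rewrite -exp_INR_mul INR2 (_ : _ * K = ln 6 + 3 * 1); last first.
      by rewrite /K (_ : 6 = 2 * 3) ?ln_mult; lra.
    rewrite exp_plus exp_ln; last by lra.
    rewrite (_ : 3 = INR 3) ?exp_INR_mul; last by rewrite /=; lra.
    apply: Rmult_le_compat_l; first by lra.
    by apply: pow_incr; have := exp_pos 1; have := exp1_le; lra.
  by have := exp_pos K; nra.
have : exp (sum_ln_div_pred b) <= exp K * ((x + 2) / 2).
  apply: Rle_trans (_ : exp (K + ln ((INR n + 1) / 2)) <= _).
    by apply: exp_mono; rewrite /K; lra.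
  rewrite exp_plus exp_ln; last by lra.
  by apply: Rmult_le_compat_l; [left; apply: exp_pos | lra].
have := Rmult_le_compat_r ((x + 2) / 2) _ _ ltac:(lra) expK.
lra.
Qed.

(** * The upper bound *)

(** In [(4 * b) ^ N.+1] the exponent exceeds [N] by one.  As [N >= b.+1], the
    extra factor [4 * b] is at most [2 ^ N], and at most [1.1 ^ N] when
    [b >= 64]. *)
Lemma mul4_le_pow2 b : (2 <= b)%N -> (4 * b <= 2 ^ b.+1)%N.
Proof.
elim: b => // b IHb; rewrite leq_eqVlt => /orP[/eqP <-|/IHb] //.
by rewrite !expnS; lia.
Qed.

Lemma mul4_le_pow_1p1 b : (64 <= b)%N -> 4 * INR b <= 1.1 ^ b.+1.
Proof.
elim: b => // b IHb; rewrite leq_eqVlt => /orP[/eqP <-|b_ge].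
  by rewrite [INR 64]INR_IZR_INZ /=; lra.
have := IHb b_ge; have /leq_INR : (64 <= b)%N by [].
rewrite [INR 64]INR_IZR_INZ [IZR _]/= S_INR -[1.1 ^ b.+2]/(1.1 * 1.1 ^ b.+1).
lra.
Qed.

(** All that is left to compare is the base of the [N]-th powers: a factor [c]
    from the extra [4 * b], a factor [4 * b], and the exponential of the
    weight of the primes dividing [b]. *)
Lemma lcm_ap_le_reduced a b N :
  (0 < a)%N -> (a <= b)%N -> (2 <= b)%N -> (b + 1 <= N)%N ->
  INR (lcm_ap a b N) <= (41.30142 * (INR b * ln (INR b))) ^ N.
Proof.
move=> a_gt0 le_ab b_ge2 le_bN; have b_gt0 : (0 < b)%N by lia.
have b0 := INR_gt0 _ b_gt0.
have /leq_INR := lcm_ap_le_part_fact a b N a_gt0 le_ab.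
rewrite INR_muln INR_expn INR_muln (_ : INR 4 = 4); last by rewrite /=; lra.
set T := INR (_`_ _) => le_l.
have T0 : 0 < T by exact/INR_gt0/part_gt0.
have le_T : T <= exp (sum_ln_div_pred b) ^ N.
  by rewrite -exp_INR_mul -(exp_ln T) //; apply/exp_mono/ln_part_fact_le.
have e_gt0 := exp_pos (sum_ln_div_pred b).
suff [c [c_ge1 le_c le_e]] : exists c,
    [/\ 1 <= c, 4 * INR b <= c ^ b.+1
      & c * 4 * exp (sum_ln_div_pred b) <= 41.30142 * ln (INR b)].
  apply: (Rle_trans _ _ _ le_l).
  apply: Rle_trans (_ : (c * (4 * INR b * exp (sum_ln_div_pred b))) ^ N <= _).
    have y_gt0 : 0 < 4 * INR b by lra.
    move: (4 * INR b) y_gt0 le_c => y y_gt0 le_c.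
    rewrite -[y ^ N.+1]/(y * y ^ N) !Rpow_mult_distr -[X in _ <= X]Rmult_assoc.
    apply: Rmult_le_compat => //; try by left.
      by left; apply: Rmult_lt_0_compat => //; apply: pow_lt.
    apply: Rmult_le_compat_r; first by left; apply: pow_lt.
    by apply: (Rle_trans _ _ _ le_c); apply: Rle_pow => //; apply/leP; lia.
  apply: pow_incr; split; first by do 3?apply: Rmult_le_pos; lra.
  by have := Rmult_le_compat_r _ _ _ (Rlt_le _ _ b0) le_e; lra.
case: (ltnP b 64) => [b_lt64|b_ge64].
- exists 2; split; first by lra.
    have /leq_INR := mul4_le_pow2 b b_ge2.
    by rewrite INR_muln INR_expn [INR 4]INR_IZR_INZ INR2.
  by have := exp_sum_ln_div_pred_le_small b b_ge2 b_lt64; lra.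
- exists 1.1; split; [lra | exact: mul4_le_pow_1p1 |].
  by have := exp_sum_ln_div_pred_le_large b b_ge64; lra.
Qed.

Theorem theorem1p1 (a b : nat) (ha : (0 < a)%N) (hb : (2 <= b)%N)
    (hab : coprime a b) (n : nat) (hn : (b + 1 <= n)%N) :
  INR (lcm_ap a b n) <= (41.30142 * (INR b * ln (INR b))) ^ (n + a %/ b)%N.
Proof.
have r_gt0 : (0 < a %% b)%N.
  rewrite lt0n; apply: contraTneq hab => /eqP b_dvd_a.
  by rewrite coprime_sym /coprime (gcdn_idPl b_dvd_a); lia.
have r_le : (a %% b <= b)%N by rewrite ltnW // ltn_mod; lia.
have le_bN : (b + 1 <= n + a %/ b)%N by apply: leq_trans hn (leq_addr _ _).
apply: (Rle_trans _ _ _ _ (lcm_ap_le_reduced _ b _ r_gt0 r_le hb le_bN)).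
by apply/leq_INR/dvdn_leq; rewrite ?lcm_ap_gt0 ?lcm_ap_shift.
Qed.
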